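(* Let $k\ge 1$ be a fixed integer and let $\mathrm{sw}_{n,k}$ denote the number of smooth words of length $n$ over the alphabet $[k]$. Then, as $n\to\infty$, $$\mathrm{sw}_{n,k}\sim\frac{2}{k+1}\cot^2\!\Big(\frac{\pi}{2(k+1)}\Big)\Big(1+2\cos\frac{\pi}{k+1}\Big)^{n-1}.$$
   Context: $[k]=\{1,2,\ldots,k\}$, and $[k]^n$ is the set of words $\sigma=\sigma_1\cdots\sigma_n$ of length $n$ over $[k]$. A word $\sigma\in[k]^n$ is smooth if $|\sigma_{i+1}-\sigma_i|\le 1$ for all $1\le i\le n-1$. The notation $a_n\sim b_n$ means $a_n/b_n\to 1$ as $n\to\infty$. *)

(* Defs.v *)
From HB Require Import structures.
From mathcomp Require Import all_boot all_order all_algebra.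
From mathcomp Require Import all_classical all_reals all_analysis.

Set Implicit Arguments.
Unset Strict Implicit.
Unset Printing Implicit Defensive.

Import Order.TTheory GRing.Theory Num.Theory.
Import numFieldNormedType.Exports.

Local Open Scope ring_scope.

(* The alphabet {1, ..., k} is represented by 'I_k = {0, ..., k-1}: the letter
   a stands for a.+1, which leaves the differences of letters unchanged.
   The differences are taken in int, not with the truncated subtraction of nat.
   A pair i, j of positions with j = i + 1 is a pair of adjacent positions. *)
Definition smooth (n k : nat) (s : n.-tuple 'I_k) : bool :=
  [forall i : 'I_n, forall j : 'I_n,
     (j == i.+1 :> nat) ==>
       (`|(tnth s j : nat)%:Z - (tnth s i : nat)%:Z| <= 1)].

Definition sw (n k : nat) : nat := #|[set s : n.-tuple 'I_k | smooth s]|.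

Definition cot (R : realType) (x : R) : R := cos x / sin x.

(* Main.v *)
Require Import Defs.
From HB Require Import structures.
From mathcomp Require Import all_boot all_order all_algebra.
From mathcomp Require Import all_classical all_reals all_analysis.
From mathcomp Require Import ring lra zify.

Set Implicit Arguments.
Unset Strict Implicit.
Unset Printing Implicit Defensive.

Import Order.TTheory GRing.Theory Num.Theory.
Import numFieldNormedType.Exports.

Local Open Scope classical_set_scope.
Local Open Scope ring_scope.

(** Smooth words of length [n.+1] are the walks with [n] steps in the graph on
    the letters [1], ..., [k] that joins letters at distance at most one. The
    adjacency matrix of this graph is tridiagonal with all entries one on the
    three diagonals. With [theta = pi / k.+1], the sine vectors
    [a |-> sin (j * a * theta)] satisfy the eigenvector equation with
    eigenvalue [1 + 2 * cos (j * theta)], by the addition formulas and because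
    they vanish at the fictitious letters [0] and [k.+1] ([mode_adj]).

    For [1 <= j <= k] these vectors are orthogonal with squared norm
    [k.+1 / 2] ([mode_orthogonal]), so the all-ones vector can be expanded in
    them, with coefficients proportional to the sums of their entries
    [mode_sum j]. Walk counts follow in closed form ([swE]):
    [sw n.+1 k = 2 / k.+1 * \sum_j mode_sum j ^+ 2 * eigenval j ^+ n].

    Among [j = 1], ..., [k], the eigenvalue with [j = 1] strictly dominates the
    others in absolute value ([eigenval_dominated]), so only its term survives after division;
    its coefficient comes from [mode_sum 1 = cot (theta / 2)] ([mode_sum1]).

    All sums over modes and letters are indexed by [0], ..., [k]: the sine
    vanishes when either index is zero, so [j = 0] adds nothing although
    [eigenval 0] is the largest value. The table [mode j a] is symmetric in [j]
    and [a], so orthogonality of its rows is also that of its columns. *)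

(** * Smooth words as walks *)

Definition adj (k : nat) (a b : 'I_k) : bool := (a <= b.+1)%N && (b <= a.+1)%N.

(** Leaving the first letter out of the word turns prepending a letter into an
    application of the adjacency matrix, see [num_tailsS]. *)
Definition num_tails (k n : nat) (a : 'I_k) : nat :=
  (\sum_(t : n.-tuple 'I_k) path (@adj k) a t)%N.

Lemma smooth_sorted n k (s : n.-tuple 'I_k) : smooth s = sorted (@adj k) s.
Proof.
have adjE (a b : 'I_k) : (`|(b : nat)%:Z - (a : nat)%:Z| <= 1) = adj a b.
  by rewrite /adj; apply/idP/idP; lia.
case: n s => [|n] s; first by rewrite tuple0; apply/forallP => -[].
apply/forallP/(sortedP (thead s)) => [sm i|so i]; rewrite ?size_tuple.
  move=> lti; have /forallP /(_ (Ordinal lti)) /= := sm (Ordinal (ltnW lti)).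
  by rewrite eqxx adjE !(tnth_nth (thead s)).
apply/forallP => j; apply/implyP => /eqP ji.
by rewrite adjE !(tnth_nth (thead s)) ji so // size_tuple -ji.
Qed.

Lemma sum_tupleS (T : finType) n (F : n.+1.-tuple T -> nat) :
  (\sum_t F t = \sum_x \sum_(t : n.-tuple T) F (cons_tuple x t))%N.
Proof.
rewrite pair_big /= (reindex (fun p : T * n.-tuple T => cons_tuple p.1 p.2)) //=.
exists (fun t => (thead t, [tuple of behead t])) => [[x t] _|t _] /=.
  by rewrite theadE; congr pair; apply: val_inj.
by apply: val_inj; rewrite /= [in RHS](tuple_eta t).
Qed.

Lemma swS n k : sw n.+1 k = (\sum_(a : 'I_k) num_tails n a)%N.
Proof.
rewrite /sw -sum1dep_card big_mkcond sum_tupleS /=.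
apply: eq_bigr => a _; apply: eq_bigr => t _.
by rewrite smooth_sorted /=; case: path.
Qed.

Lemma num_tails0 k (a : 'I_k) : num_tails 0 a = 1%N.
Proof.
rewrite /num_tails (eq_bigr (fun=> 1%N)) => [|t _]; last by rewrite tuple0.
by rewrite sum1_card card_tuple expn0.
Qed.

Lemma num_tailsS k n (a : 'I_k) : num_tails n.+1 a = (\sum_(b | adj a b) num_tails n b)%N.
Proof.
rewrite /num_tails sum_tupleS [RHS]big_mkcond; apply: eq_bigr => b _ /=.
by case: adj => //=; rewrite big1.
Qed.

(** Letters at the ends of the alphabet have one neighbour fewer; a function
    vanishing at the fictitious letters [0] and [k.+1] hides this, and the
    neighbour sum gets the same three terms everywhere. *)
Lemma sum_adj (V : zmodType) k (f : nat -> V) (a : 'I_k) :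
  f 0%N = 0 -> f k.+1 = 0 ->
  \sum_(b : 'I_k | adj a b) f b.+1 = f a + f a.+1 + f a.+2.
Proof.
move=> f0 fk; have ak := ltn_ord a.
transitivity (\sum_(a <= b < a.+3) f b); last first.
  by rewrite !big_nat_recl ?big_geq// ?addr0 ?addrA //; lia.
(* Both sums become sums over all of 0, ..., k + 1 with a condition; their
   extreme terms vanish, which leaves a sum over the letters. *)
rewrite (big_nat_widen _ _ k.+2) // (big_nat_widenl a 0) //= [RHS]big_mkcond /=.
rewrite big_nat_recr // big_nat_recl //= f0 fk !if_same add0r addr0.
rewrite big_mkord [LHS]big_mkcond; apply: eq_bigr => b _.
by congr (if _ then _ else _); rewrite /adj; lia.
Qed.

(** * Trigonometric sums *)

(** Twice [sin y * sin (b * 2 * y)] is a difference of cosines at the half-integer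
    multiples of [2 * y] next to [b], so the sum telescopes. *)
Lemma sum_sin (R : realType) (y : R) n :
  2 * sin y * \sum_(b < n) sin (b%:R * (2 * y)) =
  cos y - cos (n%:R * (2 * y) - y).
Proof.
elim: n => [|n IHn]; first by rewrite big_ord0 mul0r sub0r cosN mulr0 subrr.
rewrite big_ord_recr /= mulrDr IHn.
have -> : n.+1%:R * (2 * y) - y = n%:R * (2 * y) + y by rewrite -natr1; ring.
by rewrite cosB cosD; ring.
Qed.

Lemma sum_cos (R : realType) (y : R) n :
  2 * sin y * \sum_(b < n) cos (b%:R * (2 * y)) =
  sin (n%:R * (2 * y) - y) + sin y.
Proof.
elim: n => [|n IHn]; first by rewrite big_ord0 mul0r sub0r sinN mulr0 addNr.
rewrite big_ord_recr /= mulrDr IHn.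
have -> : n.+1%:R * (2 * y) - y = n%:R * (2 * y) + y by rewrite -natr1; ring.
by rewrite sinB sinD; ring.
Qed.

Lemma sin_natpi (R : realType) m : sin (m%:R * pi) = 0 :> R.
Proof.
by elim: m => [|m IHm]; rewrite ?mul0r ?sin0// -natr1 mulrDl mul1r sinD IHm sinpi; ring.
Qed.

Lemma cos_natpi (R : realType) m : cos (m%:R * pi) = (-1) ^+ m :> R.
Proof.
elim: m => [|m IHm]; first by rewrite mul0r cos0.
by rewrite -natr1 mulrDl mul1r cosD IHm sinpi cospi exprS; ring.
Qed.

(** The bounds on [m] keep half of the angle strictly between [0] and [pi],
    which allows division by its sine in [sum_cos]. The value depends only on
    the parity of [m]; this is what makes distinct modes orthogonal. *)
Lemma sum_cos_pi (R : realType) k m : (0 < m < 2 * k.+1)%N ->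
  \sum_(j < k.+1) cos (j%:R * (m%:R * (pi / k.+1%:R))) =
  (1 - (-1) ^+ m) / 2 :> R.
Proof.
move=> /andP[m0 mk].
pose y : R := m%:R * (pi / k.+1%:R) / 2.
have k0 : k.+1%:R != 0 :> R by rewrite pnatr_eq0.
have siny : sin y != 0.
  rewrite gt_eqF // sin_gt0_pi //; apply/andP; split.
    by rewrite !(divr_gt0, mulr_gt0) ?pi_gt0 ?ltr0n.
  rewrite /y mulrA -mulrA -invfM ltr_pdivrMr ?mulr_gt0 ?ltr0n//.
  by rewrite mulrC ltr_pM2l ?pi_gt0 // -natrM ltr_nat mulnC.
have ty : m%:R * (pi / k.+1%:R) = 2 * y by rewrite /y; field.
have e := sum_cos y k.+1; rewrite ty.
have E : k.+1%:R * (2 * y) = m%:R * pi.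
  by rewrite /y; field; rewrite nat1r.
move: e; rewrite E sinB sin_natpi cos_natpi => e.
apply: (mulfI (_ : 2 * sin y != 0)); first by rewrite mulf_neq0 ?pnatr_eq0.
by rewrite e; field.
Qed.

(** * Diagonalisation *)

Definition theta (R : realType) k : R := pi / k.+1%:R.

(** For [1 <= j <= k], the entries at [a = 1, ..., k] form the [j]-th eigenvector
    of the adjacency matrix. The ordinal [a : 'I_k] stands for the letter
    [a.+1], hence the shifted arguments below. *)
Definition mode (R : realType) k (j a : nat) : R := sin (j%:R * (a%:R * theta R k)).

Definition mode_sum (R : realType) k j : R := \sum_(a < k.+1) mode R k j a.

Definition eigenval (R : realType) k j : R := 1 + 2 * cos (j%:R * theta R k).

Lemma modeC (R : realType) k j a : mode R k j a = mode R k a j.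
Proof. by rewrite /mode mulrCA. Qed.

Lemma mode0 (R : realType) k j : mode R k j 0 = 0.
Proof. by rewrite /mode mul0r mulr0 sin0. Qed.

Lemma mode_last (R : realType) k j : mode R k j k.+1 = 0.
Proof.
have k0 : k.+1%:R != 0 :> R by rewrite pnatr_eq0.
by rewrite /mode /theta mulrC (mulrC k.+1%:R) mulfVK // mulrC sin_natpi.
Qed.

(** The entries at [a - 1] and [a + 1] add up to [2 * cos (j * theta)] times the
    entry at [a], by the addition formula for the sine. *)
Lemma mode_adj (R : realType) k j (a : 'I_k) :
  \sum_(b | adj a b) mode R k j b.+1 = eigenval R k j * mode R k j a.+1.
Proof.
rewrite (sum_adj (f := mode R k j)) ?mode0 ?mode_last //.
rewrite /mode /eigenval; set t := theta R k.
have -> : j%:R * (a%:R * t) = j%:R * (a.+1%:R * t) - j%:R * t by rewrite -natr1; ring.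
have -> : j%:R * (a.+2%:R * t) = j%:R * (a.+1%:R * t) + j%:R * t.
  by rewrite -[a.+2%:R]natr1; ring.
by rewrite sinB sinD; ring.
Qed.

(** The product of two sines is half the difference of the cosines of
    [(b - a) * j * theta] and [(a + b) * j * theta]. As [b - a] and [a + b] have
    the same parity, the two cosine sums cancel unless [b - a] is zero. Summing over the
    mode index [j] gives the completeness relation directly: it expands the
    indicator of a letter in the modes. *)
Lemma mode_orthogonal (R : realType) k a b : (a < k.+1)%N -> (0 < b < k.+1)%N ->
  2 / k.+1%:R * \sum_(j < k.+1) mode R k j a * mode R k j b = (a == b)%:R.
Proof.
wlog ab : a b / (a <= b)%N.
  move=> H ak bk; have [/H|ba] := leqP a b; first exact.
  have [->|a0] := posnP a.
    by rewrite big1 ?mulr0 => [|j _]; [case: eqP bk => [<-|] | rewrite mode0 mul0r].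
  rewrite eq_sym -H ?(ltnW ba) ?a0 //; last by lia.
  by congr (_ * _); apply: eq_bigr => j _; rewrite mulrC.
move=> ak bk.
have prod (j : 'I_k.+1) : mode R k j a * mode R k j b =
   (cos (j%:R * ((b - a)%:R * theta R k)) - cos (j%:R * ((a + b)%:R * theta R k))) / 2.
  rewrite /mode natrB // natrD; set t := theta R k.
  rewrite [(b%:R - a%:R) * t]mulrBl [(a%:R + b%:R) * t]mulrDl mulrBr mulrDr.
  by rewrite cosB cosD; field.
rewrite (eq_bigr _ (fun j _ => prod j)) -mulr_suml sumrB.
have k0 : k.+1%:R != 0 :> R by rewrite pnatr_eq0.
rewrite (sum_cos_pi _ (_ : 0 < a + b < 2 * k.+1)%N); last by lia.
have [e|ne] := eqVneq a b.
  rewrite e subnn (eq_bigr (fun=> 1)) => [|j _]; last by rewrite mul0r mulr0 cos0.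
  rewrite sumr_const card_ord addnn -mul2n exprM sqrrN expr1n expr1n mulr1n; field.
  by rewrite nat1r.
rewrite (sum_cos_pi _ (_ : 0 < b - a < 2 * k.+1)%N); last by lia.
have -> : (a + b = b - a + 2 * a)%N by lia.
by rewrite exprD exprM sqrrN !expr1n mulr1 subrr mul0r mulr0.
Qed.

(** For [n = 0] this is the expansion of the all-ones vector in the modes; each
    further letter multiplies every mode by its eigenvalue. *)
Lemma num_tailsE (R : realType) k n (a : 'I_k) : (num_tails n a)%:R =
  2 / k.+1%:R * \sum_(j < k.+1) mode_sum R k j * eigenval R k j ^+ n * mode R k j a.+1.
Proof.
elim: n a => [|n IHn] a.
  rewrite num_tails0 /mode_sum.
  under eq_bigr => j _ do rewrite expr0 mulr1 mulr_suml.
  (* Summing over j first leaves a sum over b of Kronecker symbols, in which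
     only b = a + 1 survives. *)
  rewrite exchange_big mulr_sumr /=.
  rewrite (eq_bigr (fun b : 'I_k.+1 => (b == a.+1 :> nat)%:R)) => [|b _]; last first.
    by rewrite mode_orthogonal //= ltnS ltn_ord.
  rewrite (bigD1 (lift ord0 a)) //= eqxx big1 ?addr0// => b ne.
  by rewrite -[b == a.+1 :> nat]/(b == lift ord0 a) (negPf ne).
rewrite num_tailsS natr_sum (eq_bigr _ (fun b _ => IHn b)) -mulr_sumr exchange_big /=.
congr (_ * _); apply: eq_bigr => j _.
by rewrite -mulr_sumr mode_adj exprSr !mulrA.
Qed.

Lemma swE (R : realType) k n : (sw n.+1 k)%:R =
  2 / k.+1%:R * \sum_(j < k.+1) mode_sum R k j ^+ 2 * eigenval R k j ^+ n.
Proof.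
rewrite swS natr_sum (eq_bigr _ (fun a _ => num_tailsE R n a)) -mulr_sumr exchange_big /=.
congr (_ * _); apply: eq_bigr => j _.
rewrite -mulr_sumr expr2 mulrAC; congr (_ * _).
by rewrite /mode_sum big_ord_recl mode0 add0r.
Qed.

(** * The dominant mode *)

Lemma mode_sum1 (R : realType) k : mode_sum R k 1 = cot (theta R k / 2).
Proof.
set y : R := theta R k / 2.
have k0 : k.+1%:R != 0 :> R by rewrite pnatr_eq0.
have siny : sin y != 0.
  rewrite gt_eqF // sin_gt0_pi //; apply/andP; split.
    by rewrite !divr_gt0 ?pi_gt0 ?ltr0n.
  rewrite /y /theta -mulrA -invfM ltr_pdivrMr ?mulr_gt0 ?ltr0n// -natrM.
  by rewrite ltr_pMr ?pi_gt0 // ltr1n; lia.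
have e := sum_sin y k.+1.
have E : k.+1%:R * (2 * y) = pi by rewrite /y /theta; field; rewrite nat1r.
move: e; rewrite E cosB cospi sinpi => e.
apply: (mulfI (_ : 2 * sin y != 0)); first by rewrite mulf_neq0 ?pnatr_eq0.
transitivity (cos y - (-1 * cos y + 0 * sin y)); last by rewrite /cot; field.
rewrite -e; congr (_ * _); apply: eq_bigr => b _.
by rewrite /mode mul1r /y; congr (sin (_ * _)); field.
Qed.

Lemma mode_sum0 (R : realType) k : mode_sum R k 0 = 0.
Proof. by rewrite /mode_sum big1 // => a _; rewrite modeC mode0. Qed.

Lemma mode_sum1_gt0 (R : realType) k : (0 < k)%N -> 0 < mode_sum R k 1.
Proof.
move=> k0; rewrite mode_sum1 /cot.
have p0 : 0 < theta R k / 2 by rewrite !divr_gt0 ?pi_gt0 ?ltr0n.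
have p1 : theta R k / 2 < pi / 2.
  by rewrite ltr_pM2r ?invr_gt0 ?ltr0n // gtr_pMr ?pi_gt0 // invf_lt1 ?ltr0n // ltr1n.
have pip := pi_gt0 R.
by rewrite divr_gt0 ?cos_gt0_pihalf ?sin_gt0_pi //; apply/andP; split; lra.
Qed.

Lemma theta_bounds (R : realType) k j : (j <= k.+1)%N -> j%:R * theta R k \in `[0, pi].
Proof.
move=> jk; rewrite in_itv /= /theta; apply/andP; split.
  by rewrite mulr_ge0 ?divr_ge0 ?pi_ge0.
by rewrite mulrCA ger_pMr ?pi_gt0 // ler_pdivrMr ?ltr0n // mul1r ler_nat.
Qed.

Lemma cos_theta_decr (R : realType) k i j : (i < j <= k.+1)%N ->
  cos (j%:R * theta R k) < cos (i%:R * theta R k).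
Proof.
move=> /andP[ij jk]; rewrite ltr_cos ?theta_bounds //; last by lia.
by rewrite ltr_pM2r ?ltr_nat // /theta divr_gt0 ?pi_gt0 ?ltr0n.
Qed.

(** The spectrum is symmetric about [1]; for [j = 1] this expresses the smallest
    eigenvalue, the one with index [k], in terms of [cos theta]. *)
Lemma cos_theta_sym (R : realType) k j : (j <= k.+1)%N ->
  cos ((k.+1 - j)%:R * theta R k) = - cos (j%:R * theta R k).
Proof.
move=> jk; rewrite natrB // mulrBl.
have -> : k.+1%:R * theta R k = pi by rewrite /theta mulrC mulfVK ?pnatr_eq0.
by rewrite cosB cospi sinpi; ring.
Qed.

Lemma cos_theta_ge0 (R : realType) k : (0 < k)%N -> 0 <= cos (theta R k).
Proof.
move=> k0; have : cos (k%:R * theta R k) <= cos (1%:R * theta R k).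
  have [<-//|k1] := eqVneq 1%N k.
  by apply/ltW/cos_theta_decr; lia.
have := cos_theta_sym R (_ : 1 <= k.+1)%N; rewrite subSS subn0 => -> //.
by rewrite mul1r => ?; lra.
Qed.

Lemma eigenval1_gt0 (R : realType) k : (0 < k)%N -> 0 < eigenval R k 1.
Proof. by move=> /(cos_theta_ge0 R); rewrite /eigenval mul1r => ?; lra. Qed.

(** As the cosine decreases on [0, pi], the cosine of [j * theta] lies between
    that of [k * theta], which is [- cos theta], and that of [theta], the latter
    excluded. The shift by one makes the lower bound strict as well:
    [- (1 + 2 * cos theta) < 1 - 2 * cos theta]. *)
Lemma eigenval_dominated (R : realType) k j : (1 < j < k.+1)%N ->
  `|eigenval R k j / eigenval R k 1| < 1.
Proof.
move=> /andP[j1 jk]; have k0 : (0 < k)%N by lia.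
have p := eigenval1_gt0 R k0; rewrite normrM [`|_^-1|]gtr0_norm ?invr_gt0 //.
rewrite ltr_pdivrMr // mul1r ltr_norml /eigenval mul1r.
have lt1 : cos (j%:R * theta R k) < cos (1%:R * theta R k).
  by apply: cos_theta_decr; lia.
have ge1 : cos (k%:R * theta R k) <= cos (j%:R * theta R k).
  have [->//|jk'] := eqVneq j k.
  by apply/ltW/cos_theta_decr; lia.
have := cos_theta_sym R (_ : 1 <= k.+1)%N; rewrite subSS subn0 => /(_ isT) e.
by move: lt1 ge1; rewrite e mul1r => ? ?; apply/andP; split; lra.
Qed.

Theorem corollary2p5 (R : realType) (k : nat) (hk : (1 <= k)%N) :
  (fun n : nat =>
     (sw n k)%:R /
     (2 / k.+1%:R * cot (pi / (2 * k.+1%:R)) ^+ 2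
        * (1 + 2 * cos (pi / k.+1%:R)) ^+ n.-1) : R) @ \oo --> (1 : R).
Proof.
have c1 : mode_sum R k 1 = cot (pi / (2 * k.+1%:R)).
  by rewrite mode_sum1 /theta -mulrA -invfM mulrC [2 * _]mulrC mulrC.
have l1 : eigenval R k 1 = 1 + 2 * cos (pi / k.+1%:R) by rewrite /eigenval mul1r.
(* The closed form concerns words of positive length, so shift n by one. *)
rewrite -c1 -l1 -cvg_shiftS /=.
have c1n0 : mode_sum R k 1 != 0 by rewrite gt_eqF ?mode_sum1_gt0.
have eigenval1_neq0 : eigenval R k 1 != 0 by rewrite gt_eqF ?eigenval1_gt0.
pose d j := (mode_sum R k j / mode_sum R k 1) ^+ 2.
pose q j := eigenval R k j / eigenval R k 1.
have -> : (fun n => (sw n.+1 k)%:R /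
      (2 / k.+1%:R * mode_sum R k 1 ^+ 2 * eigenval R k 1 ^+ n)) =
    fun n => 1 + \sum_(2 <= j < k.+1) d j * q j ^+ n.
  apply/funext => n; rewrite swE.
  have c0 : 2 / k.+1%:R != 0 :> R by rewrite mulf_neq0 ?invr_eq0 ?pnatr_eq0.
  rewrite -[X in _ / X]mulrA -mulf_div divff // mul1r mulr_suml.
  have term j : mode_sum R k j ^+ 2 * eigenval R k j ^+ n /
      (mode_sum R k 1 ^+ 2 * eigenval R k 1 ^+ n) = d j * q j ^+ n.
    by rewrite -mulf_div /d /q !expr_div_n.
  rewrite (eq_bigr _ (fun (j : 'I_k.+1) _ => term j)).
  rewrite -(big_mkord xpredT (fun j => d j * q j ^+ n)).
  (* Mode 0 vanishes and mode 1 contributes exactly 1. *)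
  rewrite big_ltn // big_ltn //.
  rewrite {1}/d mode_sum0 mul0r expr0n mul0r add0r.
  by rewrite /d /q !divff // !expr1n mul1r.
have t0 : \sum_(2 <= j < k.+1 | (1 < j < k.+1)%N) d j * q j ^+ n @[n --> \oo] -->
    \sum_(2 <= j < k.+1 | (1 < j < k.+1)%N) (0 : R).
  apply: cvg_big => [|j jk]; first exact: add_continuous.
  exact/cvg_geometric/eigenval_dominated.
rewrite big1 // in t0; under eq_fun do rewrite big_nat.
have := cvgD (cvg_cst (1 : R)) t0; rewrite addr0; exact.
Qed.
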